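(* As formal power series in $z$, $$\sum_{n\ge 1} \tilde W_n(\mathbf{x},t) z^n = \frac{(1-t)\frac{\partial}{\partial t}E(tz)}{E(tz)-tE(z)},$$ where $E(z):=\sum_{n\ge 0} e_n(\mathbf{x}) z^n$.
   Context: For $n\ge 1$, $W_n$ is the set of Smirnov words of length $n$: words $w=w_1\cdots w_n$ over the positive integers with $w_i\ne w_{i+1}$ for all $1\le i\le n-1$ (the first and last letters may be equal). Let $\mathbf{x}=x_1,x_2,\dots$ be indeterminates and $x_w:=x_{w_1}\cdots x_{w_n}$. The cyclic descent number is $\mathrm{cdes}(w):=|\{i\in\{1,\dots,n\}: w_i>w_{i+1}\}|$, where $w_{n+1}:=w_1$. Define $\tilde W_n(\mathbf{x},t):=\sum_{w\in W_n} t^{\mathrm{cdes}(w)}x_w$. Here $e_n(\mathbf{x})$ is the elementary symmetric function of degree $n$. *)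

(* Defs.v *)
From HB Require Import structures.
From mathcomp Require Import all_boot all_order all_algebra perm finmap multiset.
From mathcomp Require Import boolp classical_sets functions cardinality fsbigop.

Set Implicit Arguments.
Unset Strict Implicit.
Unset Printing Implicit Defensive.

Import GRing.Theory.

Local Open Scope classical_set_scope.
Local Open Scope mset_scope.
Local Open Scope ring_scope.

Section SubMultisets.
Variable I : choiceType.
Implicit Types A B m : {mset I}.

Definition submsets m : seq {mset I} :=
  undup [seq seq_mset (mask (val b) m) | b <- enum {: (size m).-tuple bool}].

Lemma submsets_uniq m : uniq (submsets m).
Proof. exact: undup_uniq. Qed.

Lemma mem_submsets A m : (A \in submsets m) = (A `<=` m)%mset.
Proof.
rewrite mem_undup; apply/idP/idP.
  case/mapP=> b _ ->; apply/msubsetP=> x.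
  rewrite mset_seqE -(count_mem_mset x m).
  by apply: leq_count_subseq; exact: mask_subseq.
move=> sAm; have [s' /subseqP[b sb ->] pe] :
    exists2 s', subseq s' m & perm_eq (A : seq I) s'.
  apply/count_subseqP => x; rewrite !count_mem_mset; exact/msubsetP.
rewrite -[A]seq_mset_id (eq_seq_msetP _ _ pe).
have bE : val (tcast sb (in_tuple b)) = b by apply: val_tcast.
by apply/mapP; exists (tcast sb (in_tuple b)); rewrite ?mem_enum ?bE.
Qed.

Lemma submsets0 : submsets mset0 = [:: mset0].
Proof.
apply/perm_small_eq => //; apply: uniq_perm => // [|A].
  exact: submsets_uniq.
by rewrite mem_submsets msubset0 inE.
Qed.

Lemma big_submsetsD (R : nmodType) (F : {mset I} -> R) A m : (A `<=` m)%mset ->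
  \sum_(B <- submsets (m `\` A)) F B =
  \sum_(C <- submsets m | (A `<=` C)%mset) F (C `\` A).
Proof.
move=> sAm.
transitivity (\sum_(B <- [seq C `\` A | C <- submsets m & (A `<=` C)%mset]) F B);
  last by rewrite big_map big_filter.
apply/perm_big/uniq_perm => [||B]; first exact: submsets_uniq.
  rewrite map_inj_in_uniq ?filter_uniq ?submsets_uniq // => C D.
  rewrite !mem_filter => /andP[sAC _] /andP[sAD _] eCD.
  by rewrite -(msetBDKC sAC) -(msetBDKC sAD) eCD.
rewrite mem_submsets; apply/idP/mapP => [sBm|[C]].
  exists (A `+` B); last by rewrite msetDC msetDKBC.
  rewrite mem_filter mem_submsets; apply/andP; split.
    by apply/msubsetP=> x; rewrite msetE2 leq_addr.
  by rewrite -(msetBDKC sAm) msetDS.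
rewrite mem_filter mem_submsets => /andP[sAC sCm] ->.
by apply/msubsetP=> x; rewrite !msetE2 leq_sub2r // (msubsetP sCm).
Qed.

End SubMultisets.

(* The ring R[[I]] of formal power series over R in commuting indeterminates
   indexed by an arbitrary (possibly infinite) choiceType I. A monomial is the
   finite multiset of its indeterminates, so that `+` is the product of
   monomials and `<=` is divisibility. *)
Record mseries (I : choiceType) (R : Type) :=
  MSeries { mscoef : {mset I} -> R }.

Notation "f @_ m" := (mscoef f m)
  (at level 3, m at level 2, left associativity, format "f @_ m") : ring_scope.

HB.instance Definition _ (I : choiceType) (R : Type) :=
  gen_eqMixin (mseries I R).
HB.instance Definition _ (I : choiceType) (R : Type) :=
  gen_choiceMixin (mseries I R).

Lemma mseriesP (I : choiceType) (R : Type) (f g : mseries I R) :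
  (forall m, f@_m = g@_m) <-> f = g.
Proof.
split=> [|-> //]; case: f g => [f] [g] /= fg; congr MSeries; exact/funext.
Qed.

Section Zmodule.
Variables (I : choiceType) (R : zmodType).
Local Notation S := (mseries I R).
Implicit Types f g h : S.

Let zero : S := MSeries (fun=> 0).
Let opp f : S := MSeries (fun m => - f@_m).
Let add f g : S := MSeries (fun m => f@_m + g@_m).

Fact mseries_addA : associative add.
Proof. by move=> f g h; apply/mseriesP=> m; exact: addrA. Qed.
Fact mseries_addC : commutative add.
Proof. by move=> f g; apply/mseriesP=> m; exact: addrC. Qed.
Fact mseries_add0 : left_id zero add.
Proof. by move=> f; apply/mseriesP=> m; exact: add0r. Qed.
Fact mseries_addN : left_inverse zero opp add.
Proof. by move=> f; apply/mseriesP=> m; exact: addNr. Qed.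

HB.instance Definition _ := GRing.isZmodule.Build S
  mseries_addA mseries_addC mseries_add0 mseries_addN.

Lemma mscoef0 m : (0 : S)@_m = 0. Proof. by []. Qed.
Lemma mscoefN f m : (- f)@_m = - f@_m. Proof. by []. Qed.
Lemma mscoefD f g m : (f + g)@_m = f@_m + g@_m. Proof. by []. Qed.
Lemma mscoefB f g m : (f - g)@_m = f@_m - g@_m. Proof. by []. Qed.
Lemma mscoef_sum (J : Type) (r : seq J) (P : pred J) (F : J -> S) m :
  (\sum_(j <- r | P j) F j)@_m = \sum_(j <- r | P j) (F j)@_m.
Proof. exact: (big_morph (fun f => f@_m)). Qed.

End Zmodule.

(* Products and monomials are locked so that conversion does not compute with
   multisets; see mscoefM and msmonoE. *)
HB.lock Definition mseries_mul (I : choiceType) (R : comNzRingType)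
    (f g : mseries I R) : mseries I R :=
  MSeries (fun m => \sum_(A <- submsets m) f@_A * g@_(m `\` A)).

Section Ring.
Variables (I : choiceType) (R : comNzRingType).
Local Notation S := (mseries I R).
Implicit Types (f g h : S) (m : {mset I}).

Let one : S := MSeries (fun m => (m == mset0)%:R).
Local Notation mul := (@mseries_mul I R).

Let mulE f g m :
  (mul f g)@_m = \sum_(A <- submsets m) f@_A * g@_(m `\` A).
Proof. by rewrite mseries_mul.unlock. Qed.

Fact mseries_mulA : associative mul.
Proof.
move=> f g h; apply/mseriesP=> m; rewrite !mulE.
transitivity (\sum_(A <- submsets m) \sum_(C <- submsets m | (A `<=` C)%mset)
    f@_A * g@_(C `\` A) * h@_(m `\` C)).
  rewrite !big_seq; apply: eq_bigr => A; rewrite mem_submsets => sAm.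
  rewrite mulE (big_submsetsD (fun B => g@_B * h@_(m `\` A `\` B)) sAm) mulr_sumr.
  apply: eq_bigr => C sAC; rewrite mulrA; congr (_ * h@_ _).
  by rewrite -msetBDA msetBDKC.
rewrite (exchange_big_dep predT) //= !big_seq; apply: eq_bigr => C.
rewrite mem_submsets => sCm; rewrite mulE mulr_suml -big_filter.
apply/perm_big/uniq_perm; rewrite ?filter_uniq ?submsets_uniq // => A.
rewrite mem_filter !mem_submsets andb_idr // => sAC; exact: msubset_trans sCm.
Qed.

Fact mseries_mulC : commutative mul.
Proof.
move=> f g; apply/mseriesP=> m; rewrite !mulE.
have pm : perm_eq [seq m `\` A | A <- submsets m] (submsets m).
  apply: uniq_perm; rewrite ?submsets_uniq //.
    rewrite map_inj_in_uniq ?submsets_uniq // => A B.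
    rewrite !mem_submsets => sA sB e.
    by rewrite -(msetBBK sA) -(msetBBK sB) e.
  move=> A; rewrite mem_submsets; apply/mapP/idP => [[B]|sA].
    by rewrite mem_submsets => sB ->; apply/msubsetP=> x; rewrite msetE2 leq_subr.
  exists (m `\` A); last by rewrite msetBBK.
  by rewrite mem_submsets; apply/msubsetP=> x; rewrite msetE2 leq_subr.
rewrite -(perm_big _ pm) big_map !big_seq; apply: eq_bigr => A.
by rewrite mem_submsets => sA; rewrite mulrC msetBBK.
Qed.

Fact mseries_mul1 : left_id one mul.
Proof.
move=> f; apply/mseriesP=> m; rewrite mulE.
rewrite (bigD1_seq mset0) ?submsets_uniq ?mem_submsets ?msub0set //=.
rewrite eqxx mul1r big1 ?addr0 => [|A /= /negPf->]; last by rewrite mul0r.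
by congr (f@_ _); apply/msetP=> x; rewrite !msetE2 mset0E subn0.
Qed.

Fact mseries_mulDl : left_distributive mul +%R.
Proof.
move=> f g h; apply/mseriesP=> m; rewrite mscoefD !mulE -big_split.
by apply: eq_bigr => A _; rewrite mulrDl.
Qed.

Fact mseries_1neq0 : one != 0.
Proof.
apply/eqP=> /mseriesP/(_ mset0)/eqP; rewrite /= eqxx; exact/negP/oner_neq0.
Qed.

HB.instance Definition _ := GRing.Zmodule_isComNzRing.Build S
  mseries_mulA mseries_mulC mseries_mul1 mseries_mulDl mseries_1neq0.

Lemma mscoef1 m : (1 : S)@_m = (m == mset0)%:R. Proof. by []. Qed.
Lemma mscoefM f g m :
  (f * g)@_m = \sum_(A <- submsets m) f@_A * g@_(m `\` A).
Proof. exact: mulE. Qed.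

Lemma mscoefM0 f g : (f * g)@_mset0 = f@_mset0 * g@_mset0.
Proof.
rewrite mscoefM submsets0 big_seq1; congr (_ * g@_ _).
by apply/msetP=> x; rewrite msetE2 mset0E.
Qed.

(* Units are the series having an inverse; the inverse of any other series is,
   by convention, the series itself. *)
Let is_unit : {pred S} := fun f => `[< exists g, g * f = 1 >].
Let inverse f : S :=
  if pselect (exists g, g * f = 1) is left fV then sval (cid fV) else f.

Fact mseries_mulVx : {in is_unit, left_inverse 1 inverse *%R}.
Proof.
move=> f /asboolP uf; rewrite /inverse; case: pselect => // fV.
exact: (svalP (cid fV)).
Qed.
Fact mseries_unitPl f g : g * f = 1 -> is_unit f.
Proof. by move=> gf; apply/asboolP; exists g. Qed.
Fact mseries_invr_out : {in [predC is_unit], inverse =1 id}.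
Proof.
by move=> f /asboolPn uf; rewrite /inverse; case: pselect.
Qed.

HB.instance Definition _ := GRing.ComNzRing_hasMulInverse.Build S
  mseries_mulVx mseries_unitPl mseries_invr_out.

End Ring.

Arguments mscoef : simpl never.

HB.lock Definition msmono (I : choiceType) (R : comNzRingType)
    (m0 : {mset I}) : mseries I R := MSeries (fun m => (m == m0)%:R).

Section RingTheory.
Variables (I : choiceType) (R : comNzRingType).
Local Notation S := (mseries I R).
Implicit Types (f g h : S) (A B m : {mset I}).

Lemma size_msetD (A B : {mset I}) : size (A `+` B) = (size A + size B)%N.
Proof.
rewrite -size_cat; apply/perm_size/allP => x _ /=.
by rewrite count_cat !count_mem_mset msetE2.
Qed.

Lemma mscoefX_small f k m :
  f@_mset0 = 0 -> (size m < k)%N -> (f ^+ k)@_m = 0.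
Proof.
move=> f0; elim: k m => // k IH m lt_mk; rewrite exprS mscoefM big_seq.
apply: big1 => A; rewrite mem_submsets => sAm.
have [->|A0] := eqVneq A mset0; first by rewrite f0 mul0r.
rewrite IH ?mulr0 // -ltnS (leq_trans _ lt_mk) // ltnS -{2}(msetBDKC sAm).
rewrite size_msetD -[X in (X < _)%N]add0n ltn_add2r lt0n.
by apply: contra A0 => /nilP A0; rewrite -[A]seq_mset_id A0; apply/eqP/msetP=> x;
   rewrite mset_seqE mset0E.
Qed.

Lemma mseries_unit1 f : f@_mset0 = 1 -> f \is a GRing.unit.
Proof.
move=> f0; pose h := 1 - f.
have h0 : h@_mset0 = 0 by rewrite mscoefB mscoef1 eqxx f0 subrr.
pose p N : S := \sum_(k < N) h ^+ k.
have pE N m : (size m < N)%N -> (p N)@_m = (p (size m).+1)@_m.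
  move=> lt_mN; rewrite !mscoef_sum -!(big_mkord xpredT (fun k => (h ^+ k)@_m)).
  rewrite (@big_cat_nat _ _ _ (size m).+1) //= -[RHS]addr0; congr (_ + _).
  by rewrite big_nat big1 // => k /andP[lt_mk _]; rewrite mscoefX_small.
pose g : S := MSeries (fun m => (p (size m).+1)@_m).
suff gf : f * g = 1 by apply/asboolP; exists g; rewrite mulrC.
apply/mseriesP=> m; transitivity ((f * p (size m).+1)@_m).
  rewrite !mscoefM !big_seq; apply: eq_bigr => A.
  rewrite mem_submsets => sAm; congr (_ * _); rewrite /= [RHS]pE //.
  by rewrite ltnS -{2}(msetBDKC sAm) size_msetD leq_addl.
have -> : f * p (size m).+1 = 1 - h ^+ (size m).+1.
  have -> : f = - (h - 1) by rewrite /h addrAC subrr add0r opprK.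
  by rewrite mulNr -subrX1 opprB.
by rewrite mscoefB mscoefX_small // subr0.
Qed.

Local Notation msmono := (@msmono I R).

Definition msvar (v : I) : S := msmono [mset v].

Lemma msmonoE m0 m : (msmono m0)@_m = (m == m0)%:R.
Proof. by rewrite msmono.unlock. Qed.

Lemma msmono0 : msmono mset0 = 1.
Proof. by apply/mseriesP=> m; rewrite msmonoE mscoef1. Qed.

Lemma msmonoM A B : msmono A * msmono B = msmono (A `+` B).
Proof.
apply/mseriesP=> m; rewrite mscoefM msmonoE.
under eq_bigr do rewrite !msmonoE.
have [->|mAB] := eqVneq m (A `+` B); last first.
  rewrite big_seq big1 // => C; rewrite mem_submsets => sCm.
  have [eCA|] := eqVneq C A; last by rewrite mul0r.
  have [eB|] := eqVneq _ B; last by rewrite mulr0.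
  by rewrite -(msetBDKC sCm) eB eCA eqxx in mAB.
have sA : (A `<=` A `+` B)%mset.
  by apply/msubsetP=> x; rewrite msetE2 leq_addr.
rewrite (bigD1_seq A) ?submsets_uniq ?mem_submsets //= eqxx mul1r.
rewrite msetDC msetDKBC eqxx big1 ?addr0 // => C /negPf->; exact: mul0r.
Qed.

Lemma msvar_coef0 v : (msvar v)@_mset0 = 0.
Proof.
by rewrite msmonoE; case: eqP => // /msetP/(_ v); rewrite mset0E msetnxx.
Qed.

Lemma msvarX v k : msvar v ^+ k = msmono (msetn k v).
Proof.
elim: k => [|k IH]; first by rewrite msetn0 msmono0.
rewrite exprS IH msmonoM; congr msmono; apply/msetP=> x.
by rewrite msetE2 !msetnE; case: (x == v).
Qed.

Lemma prod_msvar (r : seq I) : \prod_(v <- r) msvar v = msmono (seq_mset r).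
Proof.
elim: r => [|v r IH].
  by rewrite big_nil -msmono0; congr msmono; apply/msetP=> x;
     rewrite mset_seqE mset0E.
by rewrite big_cons {}IH msmonoM mset_cons.
Qed.

Definition mspderiv (v : I) (f : S) : S :=
  MSeries (fun m => f@_(v +` m) *+ (m v).+1).

(* Coefficientwise infinite sums. The sum over a finitely supported set is 0
   when the support is infinite, so mssum is only meaningful for summable
   families. *)
Definition summable (J : choiceType) (A : set J) (F : J -> S) : Prop :=
  forall m, finite_set (A `&` [set j | (F j)@_m != 0]).
Definition mssum (J : choiceType) (A : set J) (F : J -> S) : S :=
  MSeries (fun m => \sum_(j \in A) (F j)@_m).

Lemma mspderivE v f m : (mspderiv v f)@_m = f@_(v +` m) *+ (m v).+1.
Proof. by []. Qed.

Lemma mssumE (J : choiceType) (A : set J) (F : J -> S) m :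
  (mssum A F)@_m = \sum_(j \in A) (F j)@_m.
Proof. by []. Qed.

Lemma summable_powers (A : set nat) (a : nat -> S) f :
  f@_mset0 = 0 -> summable A (fun n => a n * f ^+ n).
Proof.
move=> f0 m; apply: (@sub_finite_set _ _ `I_(size m).+1); last exact: finite_II.
move=> n /= [_]; apply: contra_neqT; rewrite -leqNgt => lt_mn.
rewrite mscoefM big_seq big1 // => B; rewrite mem_submsets => sBm.
rewrite mscoefX_small ?mulr0 // (leq_trans _ lt_mn) // ltnS.
by rewrite -{2}(msetBDKC sBm) size_msetD leq_addl.
Qed.

End RingTheory.

Arguments msmono {I R} m0.
Arguments msvar {I R} v.

Notation "\mssum_ ( j '\in' A ) F" := (mssum A (fun j => F))
  (at level 41, F at level 41, j at level 0, A at level 60,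
   format "'[' \mssum_ ( j  '\in'  A ) '/  '  F ']'") : ring_scope.

Notation letter := {a : nat | (0 < a)%N}.

Inductive indet := IndT | IndZ | IndX of letter.

Definition indet_code (v : indet) : option (option letter) :=
  match v with IndT => None | IndZ => Some None | IndX a => Some (Some a) end.
Definition indet_decode (c : option (option letter)) : indet :=
  match c with None => IndT | Some None => IndZ | Some (Some a) => IndX a end.
Lemma indet_codeK : cancel indet_code indet_decode.
Proof. by case. Qed.
HB.instance Definition _ := Choice.copy indet (can_type indet_codeK).

(* The ring Z[[t, z, x_1, x_2, ...]]; it contains Z[t][[x_1, x_2, ...]][[z]]. *)
Notation series := (mseries indet int).

Definition vt : series := msvar IndT.
Definition vz : series := msvar IndZ.
Definition vx (a : letter) : series := msvar (IndX a).

Definition smirnov (w : seq letter) : bool := sorted (fun a b => a != b) w.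

(* ordS i is the cyclic successor of i in 'I_n. *)
Definition cdes (n : nat) (w : n.-tuple letter) : nat :=
  #|[pred i : 'I_n | (val (tnth w (ordS i)) < val (tnth w i))%N]|.

Definition Wsmirnov (n : nat) : series :=
  \mssum_(w \in [set w : n.-tuple letter | smirnov w])
    (vt ^+ cdes w * \prod_(a <- w) vx a).

Definition elemsym (n : nat) : series :=
  \mssum_(J \in [set J : {fset letter} | #|` J| = n]) \prod_(a <- J) vx a.

Definition Eseries (u : series) : series :=
  \mssum_(n \in [set: nat]) (elemsym n * u ^+ n).

Lemma word_coef (k : nat) (w : seq letter) (m : {mset indet}) :
  (vt ^+ k * \prod_(a <- w) vx a)@_m != 0 ->
  forall a, count_mem a w = m (IndX a).
Proof.
rewrite -(big_map IndX xpredT msvar) prod_msvar /vt msvarX msmonoM msmonoE.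
case: (eqVneq m) => [-> _ a|]; last by rewrite eqxx.
rewrite msetE2 msetnE /= mset_seqE count_map.
by apply: eq_count.
Qed.

Lemma summable_Wsmirnov n : summable [set w : n.-tuple letter | smirnov w]
  (fun w => vt ^+ cdes w * \prod_(a <- w) vx a).
Proof.
move=> m; set D := (_ `&` _)%classic.
have [-> //|/set0P[w0 [_ /word_coef w0m]]] := eqVneq D set0.
apply: (@sub_finite_set _ _
  ((fun s : 'S_n => [tuple tnth w0 (s i) | i < n]) @` setT)); last first.
  by apply: finite_image; exact: finite_finset.
move=> w [_ /word_coef wm].
have /tuple_permP[s ws] : perm_eq w w0.
  by apply/allP => a _ /=; rewrite wm w0m.
by exists s => //; apply: val_inj; rewrite /= ws.
Qed.

Lemma summable_elemsym n : summable [set J : {fset letter} | #|` J| = n]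
  (fun J => \prod_(a <- J) vx a).
Proof.
move=> m; set D := (_ `&` _)%classic.
have coefJ (J : {fset letter}) : D J -> forall a, count_mem a J = m (IndX a).
  by case=> _; rewrite /= -[X in X@_m]mul1r => /(@word_coef 0).
have [-> //|/set0P[J0 DJ0]] := eqVneq D set0.
apply: (@sub_finite_set _ _ [set J0]); last exact: finite_set1.
move=> J DJ; apply/fsetP=> a; rewrite -!has_pred1 !has_count.
by rewrite (coefJ J) // (coefJ J0).
Qed.

Lemma summable_Eseries u : u@_mset0 = 0 ->
  summable [set: nat] (fun n => elemsym n * u ^+ n).
Proof. exact: summable_powers. Qed.

Lemma summable_Wsmirnov_gf :
  summable [set n | (1 <= n)%N] (fun n => Wsmirnov n * vz ^+ n).
Proof. by apply: summable_powers; exact: msvar_coef0. Qed.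

Lemma Eseries_coef0 u : u@_mset0 = 0 -> (Eseries u)@_mset0 = 1.
Proof.
move=> u0; rewrite /Eseries mssumE.
rewrite (fsbigTE [fset 0%N]%fset) => [|n]; last first.
  rewrite inE => n0; rewrite mscoefM0 mscoefX_small ?mulr0 //.
  by rewrite enum_mset0 /= lt0n.
rewrite big_seq_fset1 expr0 mulr1 /elemsym mssumE.
rewrite (_ : [set J : {fset letter} | #|` J| = 0%N] = [set fset0]).
  by rewrite fsbig_set1 big_seq_fset0 mscoef1 eqxx.
by apply/seteqP; split=> J /= => [/cardfs0_eq|->]; rewrite ?cardfs0.
Qed.

Lemma denominator_unit :
  Eseries (vt * vz) - vt * Eseries vz \is a GRing.unit.
Proof.
have vt0 : vt@_mset0 = 0 by exact: msvar_coef0.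
have vz0 : vz@_mset0 = 0 by exact: msvar_coef0.
have vtz0 : (vt * vz)@_mset0 = 0 by rewrite mscoefM0 vt0 mul0r.
apply: mseries_unit1.
by rewrite mscoefB mscoefM0 !Eseries_coef0 // vt0 mul0r subr0.
Qed.

(* Main.v *)
(* It suffices to compare coefficients of monomials in the letters 1..k, where
   both sides may be replaced by their versions for the alphabet 1..k and E(u)
   becomes prod_c (1 + x_c u). Put y_c = x_c z, fix a letter b, and let H_c be the
   generating function of Smirnov words from c to b, weighted by t to the number
   of (linear) descents. Removing the first letter gives
     H_c = y_c ([c = b] + t sum_(d < c) H_d + sum_(d > c) H_d).
   With S_j = t sum_(d < j) H_d + sum_(d >= j) H_d this is the two-term recurrence
     (1 + t y_c) S_c = (1 + y_c) S_(c+1) + (1 - t) y_c [c = b],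
   subject to the cyclic boundary condition S_end = t S_start. Solving it yields
     S_b (E(tz) - t E(z)) = (1 - t) y_b prod_(c <> b) (1 + t y_c).
   As S_b also accounts for the closing step from b to the first letter, the
   words ending in b contribute exactly S_b to the left-hand side, and the
   right-hand sides sum over b to (1 - t) d/dt prod_c (1 + t y_c). *)
Require Import Defs.
From mathcomp Require Import all_boot all_order all_algebra finmap multiset.
From mathcomp Require Import boolp classical_sets functions cardinality fsbigop.
From mathcomp Require Import ring zify.

Set Implicit Arguments.
Unset Strict Implicit.
Unset Printing Implicit Defensive.

Import GRing.Theory.

Local Open Scope classical_set_scope.
Local Open Scope mset_scope.
Local Open Scope ring_scope.

(** * The cyclic linear system over a commutative ring *)

Section CyclicTransferSystem.
Variables (R : comNzRingType) (t : R) (k : nat) (y H : nat -> R) (b : nat).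

Let S j := t * \sum_(0 <= d < j) H d + \sum_(j <= d < k) H d.

Lemma cyclic_transfer :
  (b < k)%N ->
  (forall c, (c < k)%N ->
     H c = y c * ((c == b)%:R + (t * \sum_(0 <= d < c) H d
                                 + \sum_(c.+1 <= d < k) H d))) ->
  S b * (\prod_(0 <= c < k) (1 + t * y c) - t * \prod_(0 <= c < k) (1 + y c)) =
  (1 - t) * (y b * \prod_(0 <= c < k | c != b) (1 + t * y c)).
Proof.
move=> lt_bk eqH.
(* With [L] and [U] the sums below and above [c], S c - S c.+1 = (1 - t) H c and t S c - S c.+1 = (t
   - 1)(t L + U). *)
have S_rec c : (c < k)%N ->
    (1 + t * y c) * S c = (1 + y c) * S c.+1 + (1 - t) * y c * (c == b)%:R.
  move=> lt_ck; have := eqH c lt_ck; rewrite /S (@big_ltn _ _ _ c k) //.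
  rewrite big_nat_recr //=.
  set L := \sum_(0 <= d < c) _; set U := \sum_(c.+1 <= d < k) _.
  by move=> Hc; rewrite !mulrDr Hc; ring.
(* As [b] is not among i, ..., j - 1, the recurrence is homogeneous there and telescopes. Products
   stay on both sides, since 1 + t y_c may fail to be invertible. *)
have S_mul i j : (i <= j <= k)%N -> (j <= b)%N || (b < i)%N ->
    S i * \prod_(i <= c < j) (1 + t * y c) = S j * \prod_(i <= c < j) (1 + y c).
  case/andP=> le_ij le_jk bP; elim: j le_ij le_jk bP => [|j IH].
    by rewrite leqn0 => /eqP->; rewrite !big_geq.
  rewrite leq_eqVlt => /predU1P[->|]; first by rewrite !big_geq.
  rewrite ltnS => le_ij lt_jk bP; rewrite !big_nat_recr //= mulrA.
  rewrite (IH le_ij (ltnW lt_jk)); last by lia.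
  have := S_rec j lt_jk; have -> /= : (j == b) = false by apply/eqP; lia.
  rewrite mulr0 addr0 => e; rewrite mulrAC [S j * _]mulrC e; ring.
have split_prod (F : nat -> R) : \prod_(0 <= c < k) F c =
    \prod_(0 <= c < b) F c * F b * \prod_(b.+1 <= c < k) F c.
  by rewrite (@big_cat_nat _ _ _ b) ?(ltnW lt_bk) //= (@big_ltn _ _ _ b k) // mulrA.
have -> : \prod_(0 <= c < k | c != b) (1 + t * y c) =
    \prod_(0 <= c < b) (1 + t * y c) * \prod_(b.+1 <= c < k) (1 + t * y c).
  rewrite big_mkcond split_prod eqxx mulr1; congr (_ * _);
    apply: eq_big_nat => c cP; case: eqP => // e; lia.
rewrite !split_prod.
have := S_mul 0%N b; rewrite leqnn (ltnW lt_bk) => /(_ isT isT).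
have := S_mul b.+1 k; rewrite leqnn lt_bk ltnSn orbT => /(_ isT isT).
have := S_rec b lt_bk; rewrite eqxx mulr1.
have <- : t * S 0%N = S k by rewrite /S !(@big_geq _ _ _ k k) // big_geq // mulr0 add0r addr0.
move: (S 0%N) (S b) (S b.+1) => T Sb Sb1.
set p := \prod_(0 <= c < b) (1 + t * y c).
set q := \prod_(0 <= c < b) (1 + y c).
set p' := \prod_(b.+1 <= c < k) (1 + t * y c).
set q' := \prod_(b.+1 <= c < k) (1 + y c).
move=> e1 e2 e3.
(* Grouped so that [e1] and [e3] eliminate [Sb]; once [e2] eliminates [Sb1], the terms in [T]
   cancel. *)
have -> : Sb * (p * (1 + t * y b) * p' - t * (q * (1 + y b) * q')) =
  (1 + t * y b) * Sb * (p * p') - t * (1 + y b) * q' * (Sb * q) by ring.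
rewrite e1 -e3.
have -> : ((1 + y b) * Sb1 + (1 - t) * y b) * (p * p') =
  (1 + y b) * p * (Sb1 * p') + (1 - t) * y b * p * p' by ring.
by rewrite e2; ring.
Qed.

End CyclicTransferSystem.

(** * Partial derivatives and truncation of series *)

Section MseriesTheory.
Variables (I : choiceType) (R : comNzRingType).
Local Notation S := (mseries I R).
Implicit Types (f g h u : S) (A B m : {mset I}) (K : {mset I} -> Prop).

Lemma msubsetBl A B : (A `\` B `<=` A)%mset.
Proof. by apply/msubsetP=> x; rewrite msetE2 leq_subr. Qed.

Lemma mscoef_monoM B f m :
  (msmono B * f)@_m = if (B `<=` m)%mset then f@_(m `\` B)%mset else 0.
Proof.
rewrite mscoefM; under eq_bigr do rewrite msmonoE.
case: ifP => [sBm|nsBm].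
  rewrite (bigD1_seq B) ?submsets_uniq ?mem_submsets //= eqxx mul1r.
  by rewrite big1 ?addr0 // => C /negPf->; rewrite mul0r.
rewrite big_seq big1 // => C; rewrite mem_submsets => sCm.
by case: eqP => [e|_]; [rewrite -e sCm in nsBm | rewrite mul0r].
Qed.

Lemma mspderivD v : {morph @mspderiv I R v : f g / f + g}.
Proof. by move=> f g; apply/mseriesP=> m; rewrite mscoefD !mspderivE mscoefD mulrnDl. Qed.

Lemma mspderiv1 v : mspderiv v (1 : S) = 0.
Proof.
apply/mseriesP=> m; rewrite mspderivE mscoef1.
by case: eqP => [/msetP/(_ v)|_]; rewrite ?mul0rn // mset1DE eqxx mset0E.
Qed.

(** Together with [mspderiv_varM], this is enough of the Leibniz rule to differentiate a product of
    factors 1 + t y_c. *)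
Lemma mspderiv_monoM v B f :
  B v = 0%N -> mspderiv v (msmono B * f) = msmono B * mspderiv v f.
Proof.
move=> Bv; apply/mseriesP=> m; rewrite mspderivE !mscoef_monoM mspderivE.
have -> : (B `<=` v +` m)%mset = (B `<=` m)%mset.
  apply/msubsetP/msubsetP => sB x; have := sB x; rewrite !(msetE2, msetnE); last lia.
  by have [->|_] := eqVneq x v; rewrite ?Bv.
case: ifP => sBm; last by rewrite mul0rn.
rewrite msetE2 Bv subn0; congr (f@_ _ *+ _).
apply/msetP=> x; rewrite !(msetE2, msetnE).
by have [->|_] := eqVneq x v; rewrite ?Bv ?subn0.
Qed.

Lemma mspderiv_varM v f :
  mspderiv v (msvar v * f) = f + msvar v * mspderiv v f.
Proof.
apply/mseriesP=> m; rewrite mspderivE mscoefD !mscoef_monoM.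
have -> : ([mset v] `<=` v +` m)%mset.
  by apply/msubsetP=> x; rewrite !(msetE2, msetnE); case: (x == v).
rewrite msetD1K mulrS; congr (_ + _).
have -> : ([mset v] `<=` m)%mset = (0 < m v)%N.
  apply/msubsetP/idP => [/(_ v)|mv x]; rewrite msetnE ?eqxx //.
  by have [->|] := eqVneq x v.
case: (posnP (m v)) => [->|mv]; first by rewrite mulr0n.
rewrite mspderivE; congr (f@_ _ *+ _); last by rewrite msetE2 msetnxx; lia.
by apply/msetP=> x; rewrite !(msetE2, msetnE); have [->|_] := eqVneq x v; lia.
Qed.

(** A coefficient of a product at m involves only divisors of m, so agreement on such a [K] is
    compatible with multiplication. *)
Definition divisor_closed K := forall A m, (A `<=` m)%mset -> K m -> K A.

Definition eqon K f g := forall m, K m -> f@_m = g@_m.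

Lemma eqon_refl K f : eqon K f f. Proof. by []. Qed.

Lemma eqonB K f f' g g' : eqon K f f' -> eqon K g g' -> eqon K (f - g) (f' - g').
Proof. by move=> ef eg m Km; rewrite !mscoefB (ef _ Km) (eg _ Km). Qed.

Lemma eqonD K f f' g g' : eqon K f f' -> eqon K g g' -> eqon K (f + g) (f' + g').
Proof. by move=> ef eg m Km; rewrite !mscoefD (ef _ Km) (eg _ Km). Qed.

Lemma eqonM K f f' g g' : divisor_closed K ->
  eqon K f f' -> eqon K g g' -> eqon K (f * g) (f' * g').
Proof.
move=> clK ef eg m Km; rewrite !mscoefM !big_seq; apply: eq_bigr => A.
rewrite mem_submsets => sAm.
by rewrite ef ?eg //; apply: clK Km => //; exact: msubsetBl.
Qed.

Lemma eqon_sum K (J : Type) (r : seq J) (P : pred J) (F G : J -> S) :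
  (forall j, P j -> eqon K (F j) (G j)) ->
  eqon K (\sum_(j <- r | P j) F j) (\sum_(j <- r | P j) G j).
Proof. by move=> e m Km; rewrite !mscoef_sum; apply: eq_bigr => j Pj; exact: e. Qed.

(** Turns an infinite sum into a finite one: any list between the support at [m] and [D] will do. *)
Lemma mssum_coef_seq (J : choiceType) (D : set J) (F : J -> S) (r : seq J) m :
  uniq r -> {in r, forall j, D j} ->
  (forall j, D j -> (F j)@_m != 0 -> j \in r) ->
  (mssum D F)@_m = (\sum_(j <- r) F j)@_m.
Proof.
move=> Ur rD Fr; rewrite mssumE mscoef_sum (fsbigE r) //=.
- rewrite big_seq_cond [RHS]big_seq_cond; apply: eq_bigl => j.
  by case jr: (j \in r) => //=; apply/asboolP/rD.
- by move=> j Dj; apply: contraNeq => /(Fr j Dj).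
Qed.

Definition size_lt N m : Prop := (size m < N)%N.

Lemma size_lt_closed N : divisor_closed (size_lt N).
Proof.
move=> A m sAm; apply: leq_ltn_trans.
by rewrite -(msetBDKC sAm) size_msetD leq_addr.
Qed.

Lemma mscoefMX_small f u n m :
  u@_mset0 = 0 -> (size m < n)%N -> (f * u ^+ n)@_m = 0.
Proof.
move=> u0 lt_mn; rewrite mscoefM big_seq big1 // => B.
rewrite mem_submsets => sBm; rewrite mscoefX_small ?mulr0 //.
by rewrite (leq_trans _ lt_mn) // ltnS -{2}(msetBDKC sBm) size_msetD leq_addl.
Qed.

(** Without constant term, u^n reaches only monomials of degree at least n. *)
Lemma mssum_powers_size_lt (f : nat -> S) u N : u@_mset0 = 0 ->
  eqon (size_lt N) (\mssum_(n \in [set: nat]) (f n * u ^+ n))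
    (\sum_(n < N) f n * u ^+ n).
Proof.
move=> u0 m lt_mN; rewrite (@mssum_coef_seq _ _ _ (index_iota 0 N)) ?iota_uniq //.
  by rewrite big_mkord.
move=> n _; apply: contra_neqT; rewrite mem_index_iota /= -leqNgt => le_Nn.
by rewrite mscoefMX_small // (leq_trans lt_mN).
Qed.

End MseriesTheory.

(** * Restriction to the alphabet 1..k *)

(* The letter j + 1, so that [lett] enumerates the alphabet from index 0. *)
Definition lett (j : nat) : letter := exist _ j.+1 isT.

Lemma lett_inj : injective lett.
Proof. by move=> i j /(congr1 val)[]. Qed.

Lemma lett_pred (a : letter) : lett (val a).-1 = a.
Proof. by apply: val_inj => /=; exact/prednK/(valP a). Qed.

(** The exponents of t and z stay unrestricted, so that the set is stable under multiplication by
    t. *)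
Definition letters_le (k : nat) (m : {mset indet}) : Prop :=
  forall a : letter, IndX a \in m -> (val a <= k)%N.

Lemma letters_le_closed k : divisor_closed (letters_le k).
Proof. by move=> A m /msubset_subset sAm Km a /sAm/Km. Qed.

Lemma letters_le_exists m : exists k, letters_le k m.
Proof.
pose v (i : indet) := if i is IndX a then val a else 0%N.
exists (\max_(i <- enum_mset m) v i)%N => a am.
exact: (@leq_bigmax_seq _ _ xpredT v (IndX a)).
Qed.

(** The derivative at m reads the coefficient at t m, which has the same letters. *)
Lemma eqon_mspderivT k (f g : series) :
  eqon (letters_le k) f g -> eqon (letters_le k) (mspderiv IndT f) (mspderiv IndT g).
Proof.
move=> e m Km; rewrite !mspderivE e // => a.
by rewrite in_mset1D /= => /Km.
Qed.

(** Confines the infinite index sets of words and of letter sets to the alphabet 1..k. *)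
Lemma letters_le_word k j (w : seq letter) m : letters_le k m ->
  (vt ^+ j * \prod_(a <- w) vx a)@_m != 0 ->
  forall a, a \in w -> exists i : 'I_k, a = lett i.
Proof.
move=> Km /word_coef wm a aw.
have le_ak : (val a <= k)%N.
  by apply: Km; rewrite in_mset -wm -has_count has_pred1.
have lt_ak : ((val a).-1 < k)%N by rewrite prednK // (valP a).
by exists (Ordinal lt_ak); rewrite /= lett_pred.
Qed.

(** * E(u) as a finite product, and its derivative in t *)

Definition imlett k (J : {set 'I_k}) : {fset letter} :=
  [fset lett (val i) | i in J]%fset.

Lemma lettI_inj k : injective (fun i : 'I_k => lett i).
Proof. by move=> i j /lett_inj/val_inj. Qed.

Lemma imlett_inj k : injective (@imlett k).
Proof.
move=> J J' e; apply/setP=> i; move/fsetP: e => /(_ (lett i)); rewrite /imlett.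
by rewrite !(mem_imfset _ _ (@lettI_inj k)) /= => ->.
Qed.

Lemma perm_imlett k (J : {set 'I_k}) :
  perm_eq (imlett J) [seq lett (i : 'I_k) | i <- enum J].
Proof.
apply: uniq_perm; rewrite ?fset_uniq // ?map_inj_uniq ?enum_uniq //; first exact: lettI_inj.
move=> a; apply/imfsetP/mapP => [[i /= iJ ->]|[i]].
  by exists i; rewrite // mem_enum.
by rewrite mem_enum => iJ ->; exists i.
Qed.

Lemma card_imlett k (J : {set 'I_k}) : #|` imlett J| = #|J|.
Proof. by rewrite (perm_size (perm_imlett J)) size_map -cardE. Qed.

Lemma elemsym_letters_le k n : eqon (letters_le k) (elemsym n)
  (\sum_(J : {set 'I_k} | #|J| == n) \prod_(i in J) vx (lett i)).
Proof.
move=> m Km; rewrite /elemsym.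
rewrite (mssum_coef_seq (r := [seq imlett J | J : {set 'I_k} <- enum {: {set 'I_k}} & #|J| == n])).
- rewrite big_map big_filter big_enum_cond; congr (_@_ _); apply: eq_bigr => J _.
  by rewrite (perm_big _ (perm_imlett J)) big_map big_enum.
- by rewrite (map_inj_uniq (@imlett_inj k)) filter_uniq ?enum_uniq.
- move=> _ /mapP[J + ->]; rewrite mem_filter => /andP[/eqP Jn _] /=.
  by rewrite card_imlett.
move=> J /= Jn J0; have {}J0 : (vt ^+ 0 * \prod_(a <- J) vx a)@_m != 0 by rewrite mul1r.
have JE : J = imlett [set i : 'I_k | lett i \in J].
  apply/fsetP=> a; apply/idP/imfsetP => [aJ|[i /=]]; last by rewrite inE => iJ ->.
  have [i ai] := letters_le_word Km J0 aJ.
  by exists i; rewrite //= inE -ai.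
apply/mapP; exists [set i : 'I_k | lett i \in J]%SET => //.
by rewrite mem_filter mem_enum andbT -Jn {2}JE card_imlett eqxx.
Qed.

Lemma Eseries_letters_le k (u : series) : u@_mset0 = 0 ->
  eqon (letters_le k) (Eseries u) (\prod_(0 <= c < k) (1 + vx (lett c) * u)).
Proof.
move=> u0 m Km; rewrite /Eseries.
(* The summand [k] makes the range of [n] contain the cardinality of every subset of the alphabet,
   so the full product is recovered. *)
have lt_mN : (size m < (size m + k).+1)%N by rewrite ltnS leq_addr.
rewrite (mssum_powers_size_lt _ u0 lt_mN).
transitivity ((\sum_(n < (size m + k).+1)
   (\sum_(J : {set 'I_k} | #|J| == n) \prod_(i in J) vx (lett i)) * u ^+ n)@_m).
  apply: eqon_sum Km => n _; apply: eqonM; [exact: letters_le_closed| |by []].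
  exact: elemsym_letters_le.
congr (_@_ _); under [LHS]eq_bigr do rewrite mulr_suml.
rewrite (exchange_big_dep xpredT) //= big_mkord.
under [RHS]eq_bigr do rewrite addrC.
rewrite bigA_distr; apply: eq_bigr => J _.
have lt_JN : (#|J| < (size m + k).+1)%N.
  by rewrite ltnS (leq_trans _ (leq_addl _ _)) // -[X in (_ <= X)%N]card_ord max_card.
rewrite (big_pred1 (Ordinal lt_JN)) => [|n]; last by rewrite eq_sym.
by rewrite -big_mkcond big_split /= prodr_const.
Qed.

Lemma mspderivT_prod k :
  mspderiv IndT (\prod_(0 <= c < k) (1 + vt * (vx (lett c) * vz))) =
  \sum_(0 <= b < k) (vx (lett b) * vz) *
     \prod_(0 <= c < k | c != b) (1 + vt * (vx (lett c) * vz)).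
Proof.
elim: k => [|k IH]; first by rewrite !big_geq // mspderiv1.
rewrite [in LHS]big_nat_recr //= [in RHS]big_nat_recr //=.
set y := fun c => vx (lett c) * vz; rewrite -/(y k).
set P := \prod_(0 <= c < k) _.
(* Isolates [vt] next to [P]; the remaining factor [y k] is a monomial free of t. *)
have -> : P * (1 + vt * y k) = P + y k * (vt * P) by ring.
have yE : y k = msmono ([mset IndX (lett k)] `+` [mset IndZ]).
  by rewrite -msmonoM.
rewrite mspderivD yE mspderiv_monoM; last by rewrite !(msetE2, msetnE).
rewrite mspderiv_varM -yE.
have -> : mspderiv IndT P = \sum_(0 <= b < k) y b * \prod_(0 <= c < k | c != b) (1 + vt * y c) by exact: IH.
have -> : \prod_(0 <= c < k.+1 | c != k) (1 + vt * y c) = P.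
  rewrite big_mkcond big_nat_recr //= eqxx mulr1.
  by apply: eq_big_nat => c /andP[_ ck]; rewrite neq_ltn ck.
have -> : \sum_(0 <= b < k) y b * \prod_(0 <= c < k.+1 | c != b) (1 + vt * y c) =
   (\sum_(0 <= b < k) y b * \prod_(0 <= c < k | c != b) (1 + vt * y c)) * (1 + vt * y k).
  rewrite mulr_suml; apply: eq_big_nat => b /andP[_ bk].
  rewrite -mulrA; congr (_ * _); rewrite big_mkcond big_nat_recr //= -big_mkcond.
  by rewrite eq_sym neq_ltn bk.
move: (\sum_(0 <= b < k) _) => s; rewrite -[msvar IndT]/vt; ring.
Qed.

(** * Descent weights of words *)

(* A closing step from a letter to itself is allowed and is not a descent, whereas
   such an inner step has weight 0, see [step_wt]. *)
Definition closing_wt (c d : letter) : series :=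
  if (val d < val c)%N then vt else 1.

Definition step_wt (c d : letter) : series := closing_wt c d * (c != d)%:R.

Fixpoint path_wt (c : letter) (s : seq letter) : series :=
  if s is d :: s' then step_wt c d * path_wt d s' else 1.

Lemma path_wtE n a c s : size s = n -> path_wt c s =
  (\prod_(i < n) closing_wt (nth a (c :: s) i) (nth a s i)) *
  (smirnov (c :: s))%:R.
Proof.
move<-; elim: s c => [|d s IH] c /=; first by rewrite big_ord0 mul1r.
rewrite IH big_ord_recl /= /step_wt -[in RHS]mulnb natrM /smirnov /=; ring.
Qed.

Lemma cyclic_wt n c (s : n.-tuple letter) :
  vt ^+ cdes [tuple of c :: s] * (smirnov (c :: s))%:R =
  path_wt c s * closing_wt (last c s) c.
Proof.
rewrite (path_wtE c _ (size_tuple s)) mulrAC; congr (_ * _).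
(* The power of t becomes a product over positions; at the last one [ordS] wraps round to [c], which
   gives the closing step. *)
rewrite -prodr_const big_mkcond big_ord_recr /=; congr (_ * _).
  apply: eq_bigr => i _; rewrite /closing_wt !inE !(tnth_nth c) /=.
  by rewrite modn_small // ltnS.
rewrite /closing_wt !inE !(tnth_nth c) /= modnn /=.
by rewrite -[X in nth _ _ X](size_tuple s) -last_nth.
Qed.

(** The Smirnov condition becomes a 0/1 factor, the form in which [cyclic_wt] produces it. *)
Lemma smirnov_sum_letters_le k n : eqon (letters_le k) (Wsmirnov n)
  (\sum_(w : n.-tuple 'I_k)
     let w' := map_tuple (fun i : 'I_k => lett i) w in
     vt ^+ cdes w' * (smirnov w')%:R * \prod_(a <- w') vx a).
Proof.
pose L (w : n.-tuple 'I_k) := map_tuple (fun i : 'I_k => lett i) w.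
have L_inj : injective L.
  by move=> v w /(congr1 val) /= /(inj_map (@lettI_inj k))/val_inj.
move=> m Km; rewrite /Wsmirnov.
rewrite (mssum_coef_seq (r := [seq L w | w : n.-tuple 'I_k <- enum {: n.-tuple 'I_k} & smirnov (L w)])).
- rewrite big_map big_filter big_enum_cond; congr (_@_ _).
  rewrite big_mkcond; apply: eq_bigr => w _ /=.
  by case: smirnov; rewrite ?mulr1 // mulr0 mul0r.
- by rewrite (map_inj_uniq L_inj) filter_uniq ?enum_uniq.
- by move=> _ /mapP[w + ->]; rewrite mem_filter => /andP[].
move=> w /= sw w0; have wk := letters_le_word Km w0.
have [v vw] : exists v, w = L v.
  have predk (a : letter) : a \in w -> ((val a).-1 < k)%N.
    by move=> /wk[i ->] /=.
  have ltw i : ((val (tnth w i)).-1 < k)%N by exact/predk/mem_tnth.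
  exists [tuple Ordinal (ltw i) | i < n]; apply: eq_from_tnth => i.
  by rewrite tnth_map tnth_mktuple /= lett_pred.
by rewrite {}vw in sw *; apply: map_f; rewrite mem_filter mem_enum andbT.
Qed.

(** * Words with given first and last letters, and their generating functions *)

Section TransferSystem.
Variables (k b : nat).

(* Words of length n + 1 from [lett c] to [lett b]. *)
Definition words_wt n c : series :=
  \sum_(s : n.-tuple 'I_k)
    let s' := [seq lett i | i : 'I_k <- s] in
    \prod_(a <- lett c :: s') vx a * path_wt (lett c) s' *
    (last (lett c) s' == lett b)%:R.

Lemma big_tuple_cons n (F : n.+1.-tuple 'I_k -> series) :
  \sum_(w : n.+1.-tuple 'I_k) F w =
  \sum_(c < k) \sum_(s : n.-tuple 'I_k) F [tuple of c :: s].
Proof.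
rewrite pair_big /=.
rewrite (reindex (fun p : 'I_k * n.-tuple 'I_k => [tuple of p.1 :: p.2])) //=.
exists (fun w => (thead w, [tuple of behead w])) => [[c s]|w] _ /=.
  by congr (_, _); apply: val_inj.
by rewrite [RHS]tuple_eta; apply: val_inj.
Qed.

Lemma words_wt0 c : words_wt 0 c = vx (lett c) * (c == b)%:R.
Proof.
rewrite /words_wt (big_pred1 [tuple]) => [|s]; last by apply/esym/eqP/tuple0.
by rewrite /= big_seq1 mulr1 (inj_eq lett_inj).
Qed.

Lemma words_wtS n c : words_wt n.+1 c =
  vx (lett c) * \sum_(0 <= d < k) step_wt (lett c) (lett d) * words_wt n d.
Proof.
rewrite /words_wt big_tuple_cons big_mkord mulr_sumr; apply: eq_bigr => d _.
rewrite !mulr_sumr; apply: eq_bigr => s _ /=.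
by rewrite !big_cons; ring.
Qed.

End TransferSystem.

(** Words are grouped by last letter [b] and first letter [c], which determine the weight of the
    closing step. *)
Lemma Wsmirnov_letters_le k n : eqon (letters_le k) (Wsmirnov n.+1)
  (\sum_(0 <= b < k) \sum_(0 <= c < k)
     closing_wt (lett b) (lett c) * words_wt k b n c).
Proof.
move=> m /smirnov_sum_letters_le->; congr (_@_ _).
rewrite exchange_big big_tuple_cons big_mkord; apply: eq_bigr => c _ /=.
under [RHS]eq_bigr do rewrite mulr_sumr.
rewrite exchange_big; apply: eq_bigr => s _ /=.
set s' := [seq lett i | i : 'I_k <- s].
have [e lst] : exists e : 'I_k, last (lett c) s' = lett e.
  by exists (last c s); rewrite /s' -(last_map (fun i : 'I_k => lett i)).
rewrite big_mkord (bigD1 e) //= [X in _ + X]big1 ?addr0 => [|d]; last first.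
  rewrite eq_sym -val_eqE /= => /negPf ed.
  by rewrite lst (inj_eq lett_inj) ed !mulr0.
have := cyclic_wt (lett c) [tuple of s'].
rewrite lst eqxx mulr1 /= => e1.
rewrite (_ : cdes _ = cdes [tuple of lett c :: [tuple of s']]); last first.
  by congr cdes; exact: val_inj.
by rewrite e1; ring.
Qed.

Lemma sum_step_wt k c (F : nat -> series) : (c < k)%N ->
  \sum_(0 <= d < k) step_wt (lett c) (lett d) * F d =
  vt * \sum_(0 <= d < c) F d + \sum_(c.+1 <= d < k) F d.
Proof.
move=> ck; rewrite (@big_cat_nat _ _ _ c) ?(ltnW ck) //= (@big_ltn _ _ _ c k) //.
rewrite {2}/step_wt eqxx mulr0 mul0r add0r mulr_sumr; congr (_ + _);
  apply: eq_big_nat => d /andP[d1 d2]; rewrite /step_wt /closing_wt (inj_eq lett_inj) /= ltnS.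
  by rewrite d2 neq_ltn d2 orbT mulr1.
by rewrite ltnNge ltnW //= neq_ltn d1 mul1r mul1r.
Qed.

(** Unlike in [sum_step_wt], the term c = b survives with weight 1, so the result is the sum S_b of
    the cyclic system. *)
Lemma sum_closing_wt k b (F : nat -> series) : (b < k)%N ->
  \sum_(0 <= c < k) closing_wt (lett b) (lett c) * F c =
  vt * \sum_(0 <= c < b) F c + \sum_(b <= c < k) F c.
Proof.
move=> bk; rewrite (@big_cat_nat _ _ _ b) ?(ltnW bk) //= mulr_sumr; congr (_ + _);
  apply: eq_big_nat => c /andP[c1 c2]; rewrite /closing_wt /= ltnS.
  by rewrite c2.
by rewrite ltnNge c1 mul1r.
Qed.

(** A word counted by [words_wt k b n c] has n + 1 letters; one [vz] is split off to leave a series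
    in the powers [vz ^+ n]. *)
Definition words_gf (k b c : nat) : series :=
  \mssum_(n \in [set: nat]) (words_wt k b n c * vz * vz ^+ n).

Lemma vz_coef0 : vz@_mset0 = 0. Proof. exact: msvar_coef0. Qed.

Lemma words_gf_rec k b c : words_gf k b c =
  vx (lett c) * vz * ((c == b)%:R +
    \sum_(0 <= d < k) step_wt (lett c) (lett d) * words_gf k b d).
Proof.
apply/mseriesP=> m.
pose K := @size_lt indet (size m).+1; have clK : divisor_closed K by exact: size_lt_closed.
pose P d := \sum_(n < (size m).+1) words_wt k b n d * vz * vz ^+ n.
have gfP d : eqon K (words_gf k b d) (P d).
  exact: mssum_powers_size_lt vz_coef0.
transitivity ((vx (lett c) * vz * ((c == b)%:R +
    \sum_(0 <= d < k) step_wt (lett c) (lett d) * P d))@_m); last first.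
  symmetry; apply: (@eqonM _ _ K) => //; last exact: ltnSn.
  apply: eqonD => //; apply: eqon_sum => d _; exact: eqonM.
(* This side keeps one more term than [P], because removing the first letter lowers the length by
   one. *)
rewrite (mssum_powers_size_lt _ vz_coef0 (leqnSn (size m).+1)); congr (_@_ _).
rewrite big_ord_recl words_wt0 /= mulr1 mulrDr; congr (_ + _); first by ring.
under [in RHS]eq_bigr do rewrite mulr_sumr.
rewrite exchange_big mulr_sumr; apply: eq_bigr => n _ /=.
rewrite /bump /= add1n words_wtS exprS [in LHS]mulr_sumr !mulr_suml mulr_sumr.
by apply: eq_bigr => d _; ring.
Qed.

Definition smirnov_gf : series :=
  \mssum_(n \in [set n | (1 <= n)%N]) (Wsmirnov n * vz ^+ n).

Lemma smirnov_gf_letters_le k : eqon (letters_le k) smirnov_gf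
  (\sum_(0 <= b < k) \sum_(0 <= c < k)
     closing_wt (lett b) (lett c) * words_gf k b c).
Proof.
move=> m Km; pose N := (size m).+1.
have -> : smirnov_gf@_m = (\sum_(n < N) Wsmirnov n.+1 * vz ^+ n.+1)@_m.
  rewrite /smirnov_gf (mssum_coef_seq (r := index_iota 1 N.+1)) ?iota_uniq //.
  - by rewrite big_add1 big_mkord.
  - by move=> n; rewrite mem_index_iota => /andP[].
  move=> n /= n1; apply: contra_neqT; rewrite mem_index_iota n1 /= -leqNgt => Nn.
  by rewrite mscoefMX_small ?vz_coef0 // (leq_trans _ Nn) // /N.
transitivity ((\sum_(n < N) (\sum_(0 <= b < k) \sum_(0 <= c < k)
     closing_wt (lett b) (lett c) * words_wt k b n c) * vz ^+ n.+1)@_m).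
  apply: eqon_sum Km => n _; apply: eqonM => //; first exact: letters_le_closed.
  exact: Wsmirnov_letters_le.
pose K := @size_lt indet N; have clK : divisor_closed K by exact: size_lt_closed.
transitivity ((\sum_(0 <= b < k) \sum_(0 <= c < k) closing_wt (lett b) (lett c) *
  (\sum_(n < N) words_wt k b n c * vz * vz ^+ n))@_m); last first.
  apply: (@eqon_sum _ _ K) => [b _|]; last exact: ltnSn.
  apply: eqon_sum => c _; apply: eqonM => // A KA.
  exact/esym/(mssum_powers_size_lt _ vz_coef0 KA).
congr (_@_ _); under eq_bigr do rewrite mulr_suml.
rewrite exchange_big; apply: eq_bigr => b _ /=.
under eq_bigr do rewrite mulr_suml.
rewrite exchange_big; apply: eq_bigr => c _ /=.
by rewrite mulr_sumr; apply: eq_bigr => n _; rewrite exprS; ring.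
Qed.

Theorem corollary2p6 :
  \mssum_(n \in [set n | (1 <= n)%N]) (Wsmirnov n * vz ^+ n) =
  (1 - vt) * mspderiv IndT (Eseries (vt * vz)) /
    (Eseries (vt * vz) - vt * Eseries vz).
Proof.
rewrite -/smirnov_gf; apply: (mulIr denominator_unit).
rewrite divrK ?denominator_unit //; apply/mseriesP=> m.
(* The alphabet is chosen after [m], so a finite one suffices for each coefficient. *)
have [k Km] := letters_le_exists m.
have clK := @letters_le_closed k.
have Ez := @Eseries_letters_le k vz vz_coef0.
have Etz : eqon (letters_le k) (Eseries (vt * vz))
    (\prod_(0 <= c < k) (1 + vt * (vx (lett c) * vz))).
  under eq_bigr do rewrite mulrCA.
  by apply: Eseries_letters_le; rewrite mscoefM0 vz_coef0 mulr0.
have := eqonM clK (@smirnov_gf_letters_le k) (eqonB Etz (eqonM clK (@eqon_refl _ _ _ vt) Ez)).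
move=> /(_ _ Km)->.
have := eqonM clK (@eqon_refl _ _ _ (1 - vt)) (eqon_mspderivT Etz).
move=> /(_ _ Km)->.
congr (_@_ _); rewrite mspderivT_prod mulr_suml mulr_sumr.
(* The identity already holds for each last letter [b] separately. *)
apply: eq_big_nat => b /andP[_ bk]; rewrite sum_closing_wt //.
apply: (@cyclic_transfer _ vt k (fun c => vx (lett c) * vz)) => // c ck.
by rewrite -sum_step_wt // -words_gf_rec.
Qed.
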